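(* Let $b,c,w_1$ be rational numbers such that $F(b,c)\neq 0$ and $Q_1(b,c)\neq 0$, such that $(b,c,w_1)$ lies on the surface $$D_1\,(w_1^2+3)^3+4\,(w_1-1)^2\,(1+w_1)^2=0,\qquad D_1=-\frac{P_1^2}{Q_1^3},$$ and such that $w_1\neq\pm 1$. Then there exists a rational number $\alpha_1$ such that $$w_1^2+3=Q_1\,\alpha_1^2,\qquad 2\,(w_1^2-1)=P_1\,\alpha_1^3 .$$
   Context: Define $F=b^2c^4-6b^2c^3+13b^2c^2-12b^2c+4b^2+c^2$, $$Q_1=\tfrac{3}{2}\,(2c^2+2b^4c^4-12b^4c^3+26b^4c^2-24b^4c+8b^4-6b^3c^4+18b^3c^3-36b^3c+24b^3+3b^2c^4+8b^2c^3-36b^2c^2+16b^2c+12b^2-6bc^3+12bc),$$ and $P_1=\dfrac{N_1}{2F}$, where $N_1=7812b^4c^4-216b^2c^4-52b^2c^3+1764b^3c^4-1200b^4c^3-1848b^4c^2+720b^4c-36bc^4-1512b^3c^3-36b^3c^8+288b^3c^2-108b^2c^6+380b^2c^5+378b^3c^7-231b^4c^8-300b^4c^7+3906b^4c^6-13b^2c^7-8904b^4c^5-882b^3c^6+18bc^6-1319b^6c^8+20952b^5c^3-11952b^5c^2+2592b^5c-48372b^6c^4+31620b^6c^3-10552b^6c^2+816b^6c+1494b^5c^8-5238b^5c^7-4c^5+7905b^6c^7-24186b^6c^6+288b^6+43740b^6c^5+7686b^5c^6+576b^7+128b^8-15372b^5c^4-1080b^7c^8-3546b^7c^6+51b^6c^9+400b^8c^8-162b^5c^9+8640b^7c^2-3456b^7c+2808b^7c^7-1560b^8c^7+3940b^8c^6+216b^7c^9-960b^8c-6240b^8c^3+9b^6c^{10}+7880b^8c^4+4b^8c^{10}-6732b^8c^5+45b^4c^9+3200b^8c^2-11232b^7c^3+7092b^7c^4-18b^7c^{10}-60b^8c^9$.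 These quantities arise in the study of rational perfect cuboids: the surface above parametrizes (via $b,c,w_1$) rational solutions of the cuboid factor equations. *)

(* Defs.v *)
From mathcomp Require Export all_boot all_order all_algebra.
Export Order.TTheory GRing.Theory Num.Theory.

Set Implicit Arguments.
Unset Strict Implicit.
Unset Printing Implicit Defensive.

Local Open Scope ring_scope.

Definition F (b c : rat) : rat :=
  b ^+ 2 * c ^+ 4 - 6%:R * b ^+ 2 * c ^+ 3 + 13%:R * b ^+ 2 * c ^+ 2
  - 12%:R * b ^+ 2 * c + 4%:R * b ^+ 2 + c ^+ 2.

Definition Q1 (b c : rat) : rat :=
  3%:R / 2%:R * (
  2%:R * c ^+ 2 + 2%:R * b ^+ 4 * c ^+ 4 - 12%:R * b ^+ 4 * c ^+ 3
  + 26%:R * b ^+ 4 * c ^+ 2 - 24%:R * b ^+ 4 * c + 8%:R * b ^+ 4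
  - 6%:R * b ^+ 3 * c ^+ 4 + 18%:R * b ^+ 3 * c ^+ 3 - 36%:R * b ^+ 3 * c
  + 24%:R * b ^+ 3 + 3%:R * b ^+ 2 * c ^+ 4 + 8%:R * b ^+ 2 * c ^+ 3
  - 36%:R * b ^+ 2 * c ^+ 2 + 16%:R * b ^+ 2 * c + 12%:R * b ^+ 2
  - 6%:R * b * c ^+ 3 + 12%:R * b * c).

(* Coefficients are written [n%:R], and not as bare ring numerals, because
   [nat] numerals beyond 5000 are then kept in decimal form: a ring numeral
   would be expanded in unary. *)
Definition N1 (b c : rat) : rat :=
  7812%:R * b ^+ 4 * c ^+ 4 - 216%:R * b ^+ 2 * c ^+ 4
  - 52%:R * b ^+ 2 * c ^+ 3 + 1764%:R * b ^+ 3 * c ^+ 4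
  - 1200%:R * b ^+ 4 * c ^+ 3 - 1848%:R * b ^+ 4 * c ^+ 2
  + 720%:R * b ^+ 4 * c - 36%:R * b * c ^+ 4 - 1512%:R * b ^+ 3 * c ^+ 3
  - 36%:R * b ^+ 3 * c ^+ 8 + 288%:R * b ^+ 3 * c ^+ 2
  - 108%:R * b ^+ 2 * c ^+ 6 + 380%:R * b ^+ 2 * c ^+ 5
  + 378%:R * b ^+ 3 * c ^+ 7 - 231%:R * b ^+ 4 * c ^+ 8
  - 300%:R * b ^+ 4 * c ^+ 7 + 3906%:R * b ^+ 4 * c ^+ 6
  - 13%:R * b ^+ 2 * c ^+ 7 - 8904%:R * b ^+ 4 * c ^+ 5
  - 882%:R * b ^+ 3 * c ^+ 6 + 18%:R * b * c ^+ 6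
  - 1319%:R * b ^+ 6 * c ^+ 8 + 20952%:R * b ^+ 5 * c ^+ 3
  - 11952%:R * b ^+ 5 * c ^+ 2 + 2592%:R * b ^+ 5 * c
  - 48372%:R * b ^+ 6 * c ^+ 4 + 31620%:R * b ^+ 6 * c ^+ 3
  - 10552%:R * b ^+ 6 * c ^+ 2 + 816%:R * b ^+ 6 * c
  + 1494%:R * b ^+ 5 * c ^+ 8 - 5238%:R * b ^+ 5 * c ^+ 7 - 4%:R * c ^+ 5
  + 7905%:R * b ^+ 6 * c ^+ 7 - 24186%:R * b ^+ 6 * c ^+ 6 + 288%:R * b ^+ 6
  + 43740%:R * b ^+ 6 * c ^+ 5 + 7686%:R * b ^+ 5 * c ^+ 6 + 576%:R * b ^+ 7
  + 128%:R * b ^+ 8 - 15372%:R * b ^+ 5 * c ^+ 4 - 1080%:R * b ^+ 7 * c ^+ 8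
  - 3546%:R * b ^+ 7 * c ^+ 6 + 51%:R * b ^+ 6 * c ^+ 9
  + 400%:R * b ^+ 8 * c ^+ 8 - 162%:R * b ^+ 5 * c ^+ 9
  + 8640%:R * b ^+ 7 * c ^+ 2 - 3456%:R * b ^+ 7 * c
  + 2808%:R * b ^+ 7 * c ^+ 7 - 1560%:R * b ^+ 8 * c ^+ 7
  + 3940%:R * b ^+ 8 * c ^+ 6 + 216%:R * b ^+ 7 * c ^+ 9
  - 960%:R * b ^+ 8 * c - 6240%:R * b ^+ 8 * c ^+ 3
  + 9%:R * b ^+ 6 * c ^+ 10 + 7880%:R * b ^+ 8 * c ^+ 4
  + 4%:R * b ^+ 8 * c ^+ 10 - 6732%:R * b ^+ 8 * c ^+ 5
  + 45%:R * b ^+ 4 * c ^+ 9 + 3200%:R * b ^+ 8 * c ^+ 2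
  - 11232%:R * b ^+ 7 * c ^+ 3 + 7092%:R * b ^+ 7 * c ^+ 4
  - 18%:R * b ^+ 7 * c ^+ 10 - 60%:R * b ^+ 8 * c ^+ 9.

(* The junk value [N1 b c / 0 = 0] is irrelevant where [F b c != 0]. *)
Definition P1 (b c : rat) : rat := N1 b c / (2%:R * F b c).

Definition D1 (b c : rat) : rat := - (P1 b c ^+ 2 / Q1 b c ^+ 3).

(* Main.v *)
Require Import Defs.
From mathcomp Require Import all_boot all_order all_algebra.
From mathcomp Require Import ring.

Local Open Scope ring_scope.

(** With [A = w1 ^+ 2 + 3] and [B = 2 * (w1 ^+ 2 - 1)], clearing denominators in the surface
    equation gives [P ^+ 2 * A ^+ 3 = Q ^+ 3 * B ^+ 2]. So [(A / Q, B / P)] lies on the cuspidal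
    cubic [x ^+ 3 = y ^+ 2], whose points away from the cusp are [(a ^+ 2, a ^+ 3)] with
    [a = y / x]. [square_cube_parameter] is this parametrization. *)

Lemma square_cube_parameter (K : fieldType) (A B P Q : K) :
  Q != 0 -> B != 0 -> P ^+ 2 * A ^+ 3 = Q ^+ 3 * B ^+ 2 ->
  exists a : K, A = Q * a ^+ 2 /\ B = P * a ^+ 3.
Proof.
move=> Q0 B0 eqPQ.
(* The right-hand side of the relation is nonzero, which forces both [P] and [A] to be nonzero. *)
have : P ^+ 2 * A ^+ 3 != 0 by rewrite eqPQ mulf_neq0 // expf_neq0.
rewrite mulf_eq0 !expf_eq0 /= negb_or => /andP[P0 A0].
(* This is the slope [y / x] with [x = A / Q] and [y = B / P]. *)
exists (B * Q / (P * A)); split.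
  have -> : Q * (B * Q / (P * A)) ^+ 2 = Q ^+ 3 * B ^+ 2 / (P ^+ 2 * A ^+ 2).
    by field; rewrite P0 A0.
  by rewrite -eqPQ; field; rewrite P0 A0.
have -> : P * (B * Q / (P * A)) ^+ 3
          = B * (Q ^+ 3 * B ^+ 2) / (P ^+ 2 * A ^+ 3).
  by field; rewrite P0 A0.
by rewrite -eqPQ; field; rewrite P0 A0.
Qed.

Theorem theorem2p1 (b c w1 : rat)
  (hF : F b c <> 0) (hQ : Q1 b c <> 0)
  (hsurf : D1 b c * (w1 ^+ 2 + 3%:R) ^+ 3
             + 4%:R * (w1 - 1) ^+ 2 * (1 + w1) ^+ 2 = 0)
  (hw1 : w1 <> 1) (hwN1 : w1 <> - 1) :
  exists alpha1 : rat,
    w1 ^+ 2 + 3%:R = Q1 b c * alpha1 ^+ 2 /\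
    2%:R * (w1 ^+ 2 - 1) = P1 b c * alpha1 ^+ 3.
Proof.
move: hsurf hQ; rewrite /D1; move: (P1 b c) (Q1 b c) => P Q hsurf /eqP Q0.
apply: square_cube_parameter => //.
  (* Here [B != 0]: [w1 ^+ 2 - 1] factors, and [w1] is neither [1] nor [- 1]. *)
  rewrite mulf_neq0 // -(expr1n _ 2) subr_sqr mulf_neq0 //.
    by rewrite subr_eq0; apply/eqP.
  by rewrite addr_eq0; apply/eqP.
apply/eqP; rewrite -subr_eq0; apply/eqP.
(* Since [4 * (w1 - 1) ^+ 2 * (1 + w1) ^+ 2] is [B ^+ 2], the surface equation times [- Q ^+ 3] is
   the required difference. *)
transitivity (- Q ^+ 3 * (- (P ^+ 2 / Q ^+ 3) * (w1 ^+ 2 + 3%:R) ^+ 3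
  + 4%:R * (w1 - 1) ^+ 2 * (1 + w1) ^+ 2)); last by rewrite hsurf mulr0.
by field.
Qed.
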